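(* Let $G=(V,E)$ be a connected 3-regular simple graph with girth $g(G)\geq 5$. If $\kappa(x,y)=0$ for every edge $xy\in E$, then $G$ is isomorphic to the Petersen graph, the Triplex, or the dodecahedral graph.
   Context: Let $G=(V,E)$ be a locally finite simple graph, let $d_x$ be the degree of $x\in V$, and let $d(x,y)$ be the length of a shortest path between $x$ and $y$. The girth $g(G)$ is the length of a shortest cycle ($\infty$ if there are no cycles). For $x\in V$ and $p\in[0,1]$ define the probability measure $\mu_x^p$ on $V$ by $\mu_x^p(x)=p$, $\mu_x^p(z)=\frac{1-p}{d_x}$ if $z$ is adjacent to $x$, and $\mu_x^p(z)=0$ otherwise. The Wasserstein distance between probability measures $\mu_1,\mu_2$ on $V$ is $$W_1(\mu_1,\mu_2)=\inf_\pi\sum_{y\in V}\sum_{x\in V}d(x,y)\pi(x,y),$$ where the infimum runs over all $\pi:V\times V\to[0,1]$ with $\mu_1(x)=\sum_{y\in V}\pi(x,y)$ for all $x$ and $\mu_2(y)=\sum_{x\in V}\pi(x,y)$ for all $y$. For an edge $xy$, set $\kappa_p(x,y)=1-W_1(\mu_x^p,\mu_y^p)$ and define the (Lin-Lu-Yau) Ollivier-Ricci curvature by $$\kappa(x,y)=\lim_{p\to1}\frac{\kappa_p(x,y)}{1-p}.$$ The graphs in the conclusion are as follows. The Petersen graph is the 10-vertex cubic graph whose vertices are the 2-element subsets of a 5-element set, two being adjacent iff they are disjoint. The Triplex is the 12-vertex cubic graph with vertices $x_1,\dots,x_{12}$ whose edges are the edges of the 12-cycle $x_1x_2\cdots x_{12}x_1$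 together with $x_1x_7,\ x_2x_{10},\ x_3x_8,\ x_4x_{12},\ x_5x_9,\ x_6x_{11}$. The dodecahedral graph is the 20-vertex cubic graph formed by the vertices and edges of the regular dodecahedron. *)

(* Defs.v *)
From HB Require Import structures.
From mathcomp Require Import all_boot all_order all_algebra finmap.
From mathcomp Require Import all_classical all_reals all_analysis.

Set Implicit Arguments.
Unset Strict Implicit.
Unset Printing Implicit Defensive.

Import Order.TTheory GRing.Theory Num.Theory.
Import numFieldNormedType.Exports.

Local Open Scope classical_set_scope.
Local Open Scope ring_scope.

(* Simple graphs; the vertex set may be infinite. *)
Record sgraph : Type := SGraph {
  vertex :> choiceType;
  adj : rel vertex;
  adj_sym : symmetric adj;
  adj_irr : irreflexive adj
}.

Arguments SGraph {vertex} adj adj_sym adj_irr.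
Arguments adj {s} x y.

Definition sg_iso (G H : sgraph) : Prop :=
  exists2 f : G -> H, bijective f & forall x y : G, adj (f x) (f y) = adj x y.

Section GraphNotions.
Variable G : sgraph.
Implicit Types (x y : G) (p c : seq G).

Definition neighbors x : set G := [set y | adj x y].

Definition locally_finite : Prop := forall x, finite_set (neighbors x).

(* Meaningful when [neighbors x] is finite ([fset_set] is empty on infinite
   sets). *)
Definition degree x : nat := #|` fset_set (neighbors x)|.

Definition regular (k : nat) : Prop := forall x, degree x = k.

(* [p] lists the vertices after [x]; hence the path has [size p] edges. *)
Definition is_path x y p : bool :=
  [&& path adj x p, uniq (x :: p) & last x p == y].

(* The empty graph is not connected. *)
Definition connected_graph : Prop :=
  [set: G] !=set0 /\ forall x y, exists p, is_path x y p.

Definition is_cycle c : bool := [&& (2 < size c)%N, uniq c & cycle adj c].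

End GraphNotions.

Section Curvature.
Variables (R : realType) (G : sgraph).
Implicit Types (x y z : G) (p : R).

Definition girth : \bar R :=
  ereal_inf [set ((size c)%:R)%:E | c in [set c : seq G | is_cycle c]].

Definition dist x y : \bar R :=
  ereal_inf [set ((size s)%:R)%:E | s in [set s : seq G | is_path x y s]].

Definition mu x p (z : G) : R :=
  if z == x then p else if adj x z then (1 - p) / (degree x)%:R else 0.

Definition coupling (mu1 mu2 : G -> R) (pi : G -> G -> R) : Prop :=
  [/\ forall x y, 0 <= pi x y <= 1,
      forall x, (mu1 x)%:E = \esum_(y in [set: G]) (pi x y)%:E
    & forall y, (mu2 y)%:E = \esum_(x in [set: G]) (pi x y)%:E].

Definition W1 (mu1 mu2 : G -> R) : \bar R :=
  ereal_inf [set (\esum_(y in [set: G]) \esum_(x in [set: G])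
                    (dist x y * (pi x y)%:E)%E)
            | pi in coupling mu1 mu2].

Definition kappa_p p x y : \bar R := (1 - W1 (mu x p) (mu y p))%E.

(* [has_curvature x y k] says that the limit defining kappa(x,y) exists and
   equals [k].  The total operator [lim] is avoided because its default value
   would be a possible curvature.  The idleness satisfies p <= 1, so the limit
   is taken from the left. *)
Definition has_curvature x y (k : \bar R) : Prop :=
  (kappa_p p x y / (1 - p)%:E)%E @[p --> (1 : R)^'-] --> k.

End Curvature.

Arguments girth R G : clear implicits.

Definition petersen_vertex : choiceType := {A : {set 'I_5} | #|A| == 2%N}.

Definition petersen_adj : rel petersen_vertex :=
  fun A B => (val A :&: val B)%SET == finset.set0.

Lemma petersen_adj_sym : symmetric petersen_adj.
Proof. by move=> A B; rewrite /petersen_adj finset.setIC. Qed.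

Lemma petersen_adj_irr : irreflexive petersen_adj.
Proof.
move=> [A /= cardA]; rewrite /petersen_adj /= finset.setIid.
by apply/negbTE; rewrite -card_gt0 (eqP cardA).
Qed.

Definition petersen : sgraph :=
  SGraph petersen_adj petersen_adj_sym petersen_adj_irr.

(* The vertex x_k of the Triplex (1 <= k <= 12) is the ordinal k - 1. *)
Definition triplex_chords : seq (nat * nat) :=
  [:: (1, 7); (2, 10); (3, 8); (4, 12); (5, 9); (6, 11)]%N.

Definition triplex_arc (i j : 'I_12) : bool :=
  (j == i.+1 %% 12 :> nat)%N || ((i.+1, j.+1) \in triplex_chords).

Definition triplex_adj : rel 'I_12 :=
  fun i j => triplex_arc i j || triplex_arc j i.

Lemma triplex_adj_sym : symmetric triplex_adj.
Proof. by move=> i j; rewrite /triplex_adj orbC. Qed.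

Lemma triplex_adj_irr : irreflexive triplex_adj.
Proof. by case; do 12?[case=> //]. Qed.

Definition triplex : sgraph :=
  SGraph triplex_adj triplex_adj_sym triplex_adj_irr.

(* The regular dodecahedron centred at the origin, in its standard coordinates:
   with phi the golden ratio, the vertices are the 8 points (+-1, +-1, +-1) and
   the 12 cyclic permutations of (0, +-1/phi, +-phi).  Its edge length is
   2/phi, and its edges join the pairs of vertices at that distance.  The
   indices in 'I_3 are added modulo 3. *)
Section Dodecahedron.
Variable R : realType.

Definition golden_ratio : R := (1 + Num.sqrt 5) / 2.

Definition is_dodecahedron_vertex (v : 'rV[R]_3) : bool :=
  [forall i, `|v 0 i| == 1] ||
  [exists i, [&& v 0 i == 0, `|v 0 (i + 1)| == golden_ratio^-1
               & `|v 0 (i + 2)| == golden_ratio]].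

Definition dodecahedron_vertex : choiceType :=
  {v : 'rV[R]_3 | is_dodecahedron_vertex v}.

Definition dodecahedron_adj : rel dodecahedron_vertex :=
  fun u v => Num.sqrt (\sum_i (val u 0 i - val v 0 i) ^+ 2)
             == 2 / golden_ratio.

Lemma dodecahedron_adj_sym : symmetric dodecahedron_adj.
Proof.
move=> u v; rewrite /dodecahedron_adj; congr (Num.sqrt _ == _).
by apply: eq_bigr => i _; rewrite -sqrrN opprB.
Qed.

Lemma dodecahedron_adj_irr : irreflexive dodecahedron_adj.
Proof.
move=> u; rewrite /dodecahedron_adj big1 => [|i _]; last first.
  by rewrite subrr expr0n.
rewrite sqrtr0; apply/negbTE; rewrite eq_sym gt_eqF// divr_gt0// divr_gt0//.
Qed.

Definition dodecahedral_graph : sgraph :=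
  SGraph dodecahedron_adj dodecahedron_adj_sym dodecahedron_adj_irr.

End Dodecahedron.

Arguments dodecahedral_graph R : clear implicits.

(* Main.v *)
Require Import Defs.
From mathcomp Require Import all_boot all_order all_algebra finmap.
From mathcomp Require Import all_classical all_reals all_analysis.
From mathcomp Require Import ring lra.

(** The proof has an analytic half, which turns vanishing curvature into a
    purely combinatorial condition, and a combinatorial half, which is an
    exhaustive search whose correctness is proved and which is then run.

    Curvature.  Let [xy] be an edge of a cubic graph of girth at least 5, let
    [z] be a neighbour of [x] other than [y], and suppose that the path [z x y]
    lies on no pentagon.  Then [z] is at distance 3 from both neighbours of
    [y] other than [x].  The distance to that pair of vertices, truncated at 3,
    is a 1-Lipschitz function with values 3, 2, 1, 0 along the way from [z] to
    the pair, and weak Kantorovich duality ([weak_duality]) applied to it shows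
    that W_1 is at least 1 + (1 - p)/3 for every idleness p between 0 and 1
    ([W1_ge]).  So kappa_p / (1 - p) is at most -1/3 and the curvature cannot
    be 0.  Hence in a flat graph every path with two edges lies on a pentagon
    ([flat_pentagons]).

    Search.  Call a finite graph drawn inside [G] a partial picture of [G].  A
    pentagon is one, since [G] has one.  A partial picture can be enlarged in
    two ways, each leaving a short list of cases.  If [a b c] is a path on no
    drawn pentagon and all three neighbours of [a] and of [c] are drawn, then
    some neighbour of [a] is adjacent to some neighbour of [c], and there are
    at most four candidates for the missing edge.  Otherwise, some drawn vertex
    may lack a neighbour, which is then another drawn vertex or a new one.  An
    edge that would close a triangle or a square, or give a vertex a fourth
    neighbour, is discarded.  When no vertex lacks a neighbour, the picture is
    closed under adjacency, so by connectedness it is all of [G].  Starting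
    from a pentagon, this process visits about a thousand pictures and always
    ends, with 10, 12 or 20 vertices, in a graph isomorphic to one of the three
    in the conclusion ([search_succeeds]).  That the outcome of the process
    describes [G] is [search_sound]. *)

Set Implicit Arguments.
Unset Strict Implicit.
Unset Printing Implicit Defensive.

Import Order.TTheory GRing.Theory Num.Theory.
Import numFieldNormedType.Exports.

Local Open Scope ring_scope.

(** * Cubic graphs and girth *)

Section Adjacency.
Variable G : sgraph.
Implicit Types x y z w : G.

Lemma adjC x y : adj x y = adj y x.
Proof. exact: adj_sym. Qed.

Lemma adj_neq x y : adj x y -> x != y.
Proof. by apply: contraTneq => ->; rewrite adj_irr. Qed.

Lemma connected_ind (P : G -> Prop) : connected_graph G ->
  (exists x, P x) -> (forall x y, P x -> adj x y -> P y) -> forall x, P x.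
Proof.
move=> [_ conn] [x Px] step y; have [p /and3P[xp _ /eqP <-]] := conn x y.
elim: p x Px xp => //= z p IH x Px /andP[xz zp].
exact: IH (step _ _ Px xz) zp.
Qed.

Definition nb x : seq G := fset_set (neighbors x).

Lemma nb_uniq x : uniq (nb x).
Proof. exact: fset_uniq. Qed.

Section Cubic.
Hypothesis G_locfin : locally_finite G.
Hypothesis G_cubic : regular G 3.

Lemma mem_nb x y : (y \in nb x) = adj x y.
Proof.
have -> : (y \in nb x) = (y \in fset_set (neighbors x)) by [].
rewrite in_fset_set; last exact: G_locfin.
by apply/idP/idP => [/set_mem|h]; last exact: mem_set.
Qed.

Lemma size_nb x : size (nb x) = 3%N.
Proof. exact: G_cubic. Qed.

Lemma nb_perm x y z : adj x y -> adj x z -> y != z ->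
  exists w, perm_eq (nb x) [:: y; z; w].
Proof.
rewrite -!mem_nb => yx zx yz.
have p1 := perm_to_rem yx; have s1 := perm_size p1.
have zr : z \in rem y (nb x) by rewrite mem_rem_uniq ?nb_uniq // inE /= eq_sym yz.
have p2 := perm_to_rem zr; have s2 := perm_size p2.
have : size (rem z (rem y (nb x))) = 1%N.
  by move: s1; rewrite size_nb /= s2 /= => -[].
case e : (rem z _) => [|w [|]] // _; exists w.
by apply: perm_trans p1 _; rewrite perm_cons -e.
Qed.

End Cubic.

Section Girth.
Variable R : realType.
Hypothesis G_girth : (5%:R%:E <= girth R G)%E.

Lemma girth_le (c : seq G) : is_cycle c -> (5 <= size c)%N.
Proof.
move=> cc; rewrite -(ler_nat R) -lee_fin; apply: le_trans G_girth _.
by apply: ereal_inf_lbound; exists c.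
Qed.

Lemma no_triangle x y z : adj x y -> adj y z -> adj z x -> False.
Proof.
move=> xy yz zx; suff /girth_le : is_cycle [:: x; y; z] by [].
rewrite /is_cycle /= !inE !negb_or xy yz zx (adj_neq xy) (adj_neq yz).
by rewrite eq_sym (adj_neq zx).
Qed.

Lemma no_square x y z w :
  adj x y -> adj y z -> adj z w -> adj w x -> x != z -> y != w -> False.
Proof.
move=> xy yz zw wx xz yw; suff /girth_le : is_cycle [:: x; y; z; w] by [].
rewrite /is_cycle /= !inE !negb_or xy yz zw wx xz yw (adj_neq xy) (adj_neq yz).
by rewrite (adj_neq zw) eq_sym (adj_neq wx).
Qed.

End Girth.

End Adjacency.

(** * Weak Kantorovich duality *)

Section Duality.
Local Open Scope classical_set_scope.
Variables (R : realType) (G : sgraph).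
Implicit Types (x y z : G) (F : G -> nat).

(** Through sums over pairs, which a bijection exchanges. *)
Lemma exchange_esum (I J : choiceType) (a : I -> J -> \bar R) :
  (forall i j, 0 <= a i j)%E ->
  (\esum_(i in [set: I]) \esum_(j in [set: J]) a i j =
   \esum_(j in [set: J]) \esum_(i in [set: I]) a i j)%E.
Proof.
move=> a0; rewrite !esum_esum //.
rewrite (@reindex_esum R _ _ ([set: J] `*`` fun=> [set: I]) _
           (fun k => (k.2, k.1))) //.
split => [//|[i j] [i' j'] _ _ /= [-> ->] //|[i j] _].
by exists (j, i).
Qed.

Lemma esum_mulrn (I : choiceType) (a : I -> R) (b : R) n :
  (forall i, 0 <= a i) -> b%:E = (\esum_(i in [set: I]) (a i)%:E)%E ->
  (b *+ n)%:E = (\esum_(i in [set: I]) (a i *+ n)%:E)%E.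
Proof.
move=> a0 ba; elim: n => [|n IH]; first by rewrite esum1.
rewrite mulrS EFinD IH ba -esumD; last 2 first.
- by move=> i _; rewrite lee_fin.
- by move=> i _; rewrite lee_fin mulrn_wge0.
by apply: eq_esum => i _; rewrite mulrS EFinD.
Qed.

Lemma esum_seq (I : choiceType) (a : I -> \bar R) (s : seq I) : uniq s ->
  (forall i, 0 <= a i)%E -> (forall i, i \notin s -> a i = 0%E) ->
  (\esum_(i in [set: I]) a i = \sum_(i <- s) a i)%E.
Proof.
move=> us a0 as0.
transitivity (\esum_(i in [set` s]) a i)%E.
  rewrite [RHS]esum_mkcond; apply: eq_esum => i _.
  by case: ifPn => // /negP h; apply/as0/negP => h'; apply/h/mem_set.
by rewrite esum_fset //; exact/esym/fsbig_seq.
Qed.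

Lemma dist_ge0 x y : (0 <= dist R x y)%E.
Proof. by apply: le_ereal_inf_tmp => _ [p _ <-]; rewrite lee_fin. Qed.

Lemma lipschitz_dist F x y : (forall x y, adj x y -> F x <= (F y).+1)%N ->
  ((F x)%:R%:E <= (F y)%:R%:E + dist R x y)%E.
Proof.
move=> lip; rewrite -leeBlDl //; apply: le_ereal_inf_tmp => _ [p xpy <-].
rewrite leeBlDl // -EFinD lee_fin -natrD ler_nat.
case/and3P: xpy => xp _ /eqP <-.
elim: p x xp => [|z p IH] x /=; first by rewrite addn0.
case/andP => xz /IH; rewrite addnS -ltnS; apply: leq_trans; exact: lip.
Qed.

(** Integrating F(x) <= F(y) + d(x, y) against a coupling.  The test function
    takes values in the natural numbers, so that all sums are of nonnegative
    terms and infinite values of the distance need no separate treatment. *)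
Lemma weak_duality F (mu1 mu2 : G -> R) (pi : G -> G -> R) :
  (forall x y, adj x y -> F x <= (F y).+1)%N -> coupling mu1 mu2 pi ->
  (\esum_(x in [set: G]) (mu1 x *+ F x)%:E <=
   \esum_(y in [set: G]) (mu2 y *+ F y)%:E +
   \esum_(y in [set: G]) \esum_(x in [set: G]) (dist R x y * (pi x y)%:E))%E.
Proof.
move=> lip [pi01 pi1 pi2].
have pi0 x y : 0 <= pi x y by case/andP: (pi01 x y).
under eq_esum do rewrite (esum_mulrn _ (pi0 _) (pi1 _)).
under [X in (_ <= X + _)%E]eq_esum do
  rewrite (esum_mulrn _ (fun x => pi0 x _) (pi2 _)).
have piF0 x y n : (0 <= (pi x y *+ n)%:E)%E by rewrite lee_fin mulrn_wge0.
have dpi0 x y : (0 <= dist R x y * (pi x y)%:E)%E.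
  by rewrite mule_ge0 ?dist_ge0 // lee_fin.
rewrite exchange_esum // -esumD; last 2 first.
- by move=> y _; apply: esum_ge0.
- by move=> y _; apply: esum_ge0.
apply: le_esum => y _; rewrite -esumD //; apply: le_esum => x _.
rewrite -!(mulr_natl (pi x y)) !EFinM -ge0_muleDl ?dist_ge0 //.
by apply: lee_wpmul2r; rewrite ?lee_fin ?lipschitz_dist.
Qed.

End Duality.

(** * Flat edges lie on pentagons *)

Section TestFunction.
Variables (R : realType) (G : sgraph).
Hypothesis G_locfin : locally_finite G.
Hypothesis G_cubic : regular G 3.
Hypothesis G_girth : (5%:R%:E <= girth R G)%E.
Implicit Types (x y z : G) (A : seq G).

Definition thicken A : seq G := A ++ flatten [seq nb a | a <- A].

(** The distance from [x] to [A], truncated at 3: each of the three terms says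
    that [x] is farther than 0, 1, 2. *)
Definition dist_to A x : nat :=
  (x \notin A) + (x \notin thicken A) + (x \notin thicken (thicken A)).

Lemma mem_thicken A x :
  reflect (x \in A \/ exists2 a, a \in A & adj a x) (x \in thicken A).
Proof.
rewrite mem_cat; apply: (iffP orP) => -[xA|h]; try by left.
  by case/flatten_mapP: h => a aA; rewrite mem_nb // => ax; right; exists a.
by right; case: h => a aA ax; apply/flatten_mapP; exists a; rewrite ?mem_nb.
Qed.

Lemma dist_to_lipschitz A x y : adj x y -> (dist_to A x <= (dist_to A y).+1)%N.
Proof.
move=> xy; rewrite /dist_to.
have step B : (x \notin thicken B <= (y \notin B))%N.
  case yB : (y \in B) => /=; last by case: (_ \notin _).
  have -> // : x \in thicken B.
  by apply/mem_thicken; right; exists y; rewrite // adj_sym.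
have := step A; have := step (thicken A).
by do 5!case: (_ \notin _).
Qed.

Lemma esum_mu_mulrn (F : G -> nat) x (p : R) : 0 <= p <= 1 ->
  (\esum_(z in [set: G]) (mu x p z *+ F z)%:E =
  (p *+ F x + ((1 - p) / 3) *+ (\sum_(z <- nb x) F z)%N)%:E)%E.
Proof.
move=> /andP[p0 p1].
have x_nb : x \notin nb x by rewrite mem_nb // adj_irr.
have dx : degree x = 3%N by exact: G_cubic.
rewrite (@esum_seq _ _ _ (x :: nb x)).
- rewrite big_cons {1}/mu eqxx EFinD; congr (_ + _)%E.
  rewrite -sumrMnr -sumEFin big_seq [RHS]big_seq; apply: eq_bigr => z zx.
  rewrite /mu dx -mem_nb // zx; case: eqVneq => // zx'.
  by move: x_nb; rewrite -{1}zx' zx.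
- by rewrite /= x_nb nb_uniq.
- move=> z; rewrite lee_fin mulrn_wge0 // /mu.
  by do 2?case: ifP => _ //; rewrite divr_ge0 ?subr_ge0 ?ler0n.
- move=> z; rewrite inE negb_or => /andP[/negPf zx /negPf znb].
  by rewrite /mu zx -mem_nb // znb mul0rn.
Qed.

Section NoPentagon.
Variables x y z : G.
Hypothesis xy : adj x y.
Hypothesis xz : adj x z.
Hypothesis yz : y != z.
Hypothesis no_pentagon : forall u v,
  ~ [/\ adj z u, adj y v, adj u v, u != x & v != x].

Let A := [seq a <- nb y | a != x].

Let mem_A a : (a \in A) = (adj y a) && (a != x).
Proof. by rewrite mem_filter mem_nb // andbC. Qed.

Let yx : adj y x. Proof. by rewrite adj_sym. Qed.

(** A closer [w] would create a triangle [x w y] or a square [x w a y]. *)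
Let far_from_A w : adj x w -> w != y -> w \notin thicken A.
Proof.
move=> xw wy; apply/negP => /mem_thicken[|[a]]; rewrite mem_A => /andP[ya ax].
  by apply: (no_triangle G_girth xw _ yx); rewrite adj_sym.
move=> aw; apply: (no_square G_girth xy ya aw); rewrite 1?adj_sym //.
  by rewrite eq_sym.
by rewrite eq_sym.
Qed.

Let x_far : x \notin thicken A.
Proof.
apply/negP => /mem_thicken[|[a]]; rewrite mem_A ?eqxx ?andbF // => /andP[ya _] ax.
exact: (no_triangle G_girth xy ya ax).
Qed.

Let y_near : y \in thicken A.
Proof.
have sA : size A = 2.
  by rewrite /A -rem_filter ?nb_uniq // size_rem ?mem_nb // size_nb.
have [a aA] : exists a, a \in A.
  by case: A sA => // a l _; exists a; rewrite mem_head.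
apply/mem_thicken; right; exists a => //.
by move: aA; rewrite mem_A adj_sym => /andP[].
Qed.

Lemma dist_to_x : dist_to A x = 2.
Proof.
rewrite /dist_to x_far mem_A eqxx andbF.
by have -> : x \in thicken (thicken A) by apply/mem_thicken; right; exists y.
Qed.

Lemma dist_to_y : dist_to A y = 1.
Proof.
by rewrite /dist_to y_near mem_cat y_near mem_A adj_irr.
Qed.

Lemma dist_to_nb w : adj x w -> w != y -> (2 <= dist_to A w)%N.
Proof.
move=> xw wy; have wt := far_from_A xw wy; rewrite /dist_to wt.
by have -> // : w \notin A; apply: contra wt => wA; rewrite mem_cat wA.
Qed.

Lemma dist_to_z : dist_to A z = 3.
Proof.
have zt : z \notin thicken A by apply: far_from_A; rewrite // eq_sym.
rewrite /dist_to zt.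
have -> : z \notin A by apply: contra zt => zA; rewrite mem_cat zA.
have [|//] := boolP (z \in thicken (thicken A)).
move=> /mem_thicken[zA|[u ut uz]]; first by move: zt; rewrite zA.
case/mem_thicken: ut => [uA|[v]].
  by case/negP: zt; apply/mem_thicken; right; exists u.
rewrite mem_A => /andP[yv vx] vu; case: (@no_pentagon u v); split=> //.
- by rewrite adj_sym.
- by rewrite adj_sym.
- apply: contraNneq x_far => <-; apply/mem_thicken; right.
  by exists v; rewrite ?mem_A ?yv.
Qed.

Lemma sum_nb_x : (6 <= \sum_(w <- nb x) dist_to A w)%N.
Proof.
have [w px] := nb_perm G_locfin G_cubic xy xz yz.
rewrite (perm_big _ px) /= !big_cons big_nil dist_to_y dist_to_z addn0.
have /andP[xw wy] : adj x w && (w != y).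
  have := nb_uniq x; rewrite (perm_uniq px) /= !inE negb_or andbT.
  case/andP => /andP[_ yw] _; rewrite eq_sym yw andbT -mem_nb //.
  by rewrite (perm_mem px) !inE eqxx !orbT.
exact: (leq_add (leqnn 4) (dist_to_nb xw wy)).
Qed.

Lemma sum_nb_y : (\sum_(w <- nb y) dist_to A w = 2)%N.
Proof.
rewrite (bigD1_seq x) ?nb_uniq ?mem_nb //= dist_to_x big_seq_cond big1 ?addn0 //.
move=> w; rewrite mem_nb // => h.
have wA : w \in A by rewrite mem_A.
by rewrite /dist_to wA !mem_cat wA.
Qed.

(** With e = (1 - p)/3, the measure at [x] gives the test function an integral
    of at least 2 (1 - 3 e) + 6 e = 2, and the one at [y] an integral of
    (1 - 3 e) + 2 e = 1 - e. *)
Lemma W1_ge (p : R) : 0 <= p <= 1 ->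
  ((1 + (1 - p) / 3)%:E <= W1 (mu x p) (mu y p))%E.
Proof.
move=> p01; have /andP[p0 p1] := p01.
apply: le_ereal_inf_tmp => _ [pi cpi <-].
have := weak_duality (@dist_to_lipschitz A) cpi.
rewrite !esum_mu_mulrn // dist_to_x dist_to_y sum_nb_y -leeBlDl //.
apply: le_trans; rewrite -EFinB lee_fin.
have e0 : 0 <= (1 - p) / 3 by rewrite divr_ge0 ?subr_ge0.
have := ler_wpMn2l e0 sum_nb_x; lra.
Qed.

(** By [W1_ge] the quotient is at most -1/3 as p tends to 1. *)
Lemma curvature_neq0 : ~ has_curvature x y (0 : \bar R)%E.
Proof.
move=> /cvge_to_le flat.
have : ((0 : \bar R) <= (- 3^-1)%:E)%E.
  apply: flat; near=> p.
  have p1 : p < 1 by near: p; exact: nbhs_left_lt.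
  have p0 : 0 < p by near: p; exact: nbhs_left_gt.
  have q0 : 0 < 1 - p by rewrite subr_gt0.
  rewrite inver gt_eqF // lee_pdivrMr // -EFinM /kappa_p.
  have /W1_ge/(leeB (lexx 1%E)) : 0 <= p <= 1 by rewrite !ltW.
  by move/le_trans; apply; rewrite -EFinB lee_fin; lra.
by rewrite lee_fin oppr_ge0 leNgt invr_gt0 ltr0n.
Unshelve. all: by end_near.
Qed.

End NoPentagon.

Lemma flat_pentagons :
  (forall x y : G, adj x y -> has_curvature x y (0 : \bar R)%E) ->
  forall a b c : G, a != c -> adj b a -> adj b c ->
  exists u v, [/\ adj a u, adj c v, adj u v, u != b & v != b].
Proof.
move=> flat a b c ac ba bc; apply: contrapT => no.
apply: (curvature_neq0 bc ba) (flat _ _ bc); first by rewrite eq_sym.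
by move=> u v h; apply: no; exists u, v.
Qed.

End TestFunction.

(** * Finite graphs as tables of neighbours *)

Section Tables.
Local Open Scope nat_scope.

Definition table := seq (seq nat).

Implicit Types (s t : table) (i j k : nat).

Definition nbs s i : seq nat := nth [::] s i.

Definition adjacency_table n (e : rel nat) : table :=
  mkseq (fun i => [seq j <- iota 0 n | e i j]) n.

Definition models (H : sgraph) s : Prop :=
  exists f : nat -> H,
  [/\ {in gtn (size s) &, injective f},
      forall v, exists2 i, i < size s & f i = v
    & {in gtn (size s) &, forall i j, adj (f i) (f j) = (j \in nbs s i)}].

Lemma models_adjacency (H : sgraph) n (e : rel nat) (f : nat -> H) :
  {in gtn n &, injective f} -> (forall v, exists2 i, i < n & f i = v) ->
  {in gtn n &, forall i j, adj (f i) (f j) = e i j} ->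
  models H (adjacency_table n e).
Proof.
move=> finj fsurj fadj; exists f; rewrite size_mkseq; split => // i j iN jN.
rewrite fadj // /nbs nth_mkseq // mem_filter mem_iota /= add0n.
by rewrite [j < n]jN andbT.
Qed.

Lemma models_iso (G H : sgraph) s : models G s -> models H s -> sg_iso G H.
Proof.
move=> [f [finj fsurj fadj]] [g [ginj gsurj gadj]].
have inv (K : sgraph) (h : nat -> K) :
    (forall v, exists2 i, i < size s & h i = v) ->
    exists h' : K -> nat, forall v, h' v < size s /\ h (h' v) = v.
  move=> hsurj; have : forall v, exists i, i < size s /\ h i = v.
    by move=> v; have [i i1 i2] := hsurj v; exists i.
  by move=> /boolp.choice[h' hh]; exists h'.
have [f' f'K] := inv _ _ fsurj; have [g' g'K] := inv _ _ gsurj.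
have f's v : f' v \in gtn (size s) by rewrite inE; case: (f'K v).
have g's v : g' v \in gtn (size s) by rewrite inE; case: (g'K v).
exists (g \o f').
  exists (f \o g') => v /=.
    have -> : g' (g (f' v)) = f' v by apply: ginj => //; case: (g'K (g (f' v))).
    by case: (f'K v).
  have -> : f' (f (g' v)) = g' v by apply: finj => //; case: (f'K (f (g' v))).
  by case: (g'K v).
move=> x y /=; rewrite gadj // -fadj //.
by case: (f'K x) => _ ->; case: (f'K y) => _ ->.
Qed.

Definition relabels t s (p : seq nat) : bool :=
  [&& size s == size t, size p == size t, uniq p, all (gtn (size s)) p
    & all (fun i => all (fun j =>
             (nth 0 p j \in nbs s (nth 0 p i)) == (j \in nbs t i))
             (iota 0 (size t))) (iota 0 (size t))].

Lemma models_relabels (G : sgraph) s t p :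
  models G s -> relabels t s p -> models G t.
Proof.
move=> [f [finj fsurj fadj]] /and5P[/eqP st /eqP pt up /allP ps /allP pe].
have pin i : i < size t -> nth 0 p i \in gtn (size s).
  by move=> it; rewrite inE; apply: ps; rewrite mem_nth ?pt.
exists (fun i => f (nth 0 p i)); split.
- move=> i j; rewrite !inE => it jt /finj -/(_ (pin _ it) (pin _ jt)) /eqP.
  by rewrite nth_uniq ?pt // => /eqP.
- move=> v; have [i si <-] := fsurj v.
  have ip : i \in p.
    have sub : {subset p <= iota 0 (size s)} by move=> k /ps; rewrite mem_iota.
    have le_sp : size (iota 0 (size s)) <= size p by rewrite size_iota pt st.
    by have [_ ->] := uniq_min_size up sub le_sp; rewrite mem_iota.
  by exists (index i p); rewrite ?nth_index // -pt index_mem.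
- move=> i j; rewrite !inE => it jt; rewrite fadj ?pin //.
  have /pe /allP : i \in iota 0 (size t) by rewrite mem_iota.
  by move=> /(_ j); rewrite mem_iota /= add0n jt => /(_ isT) /eqP.
Qed.

(** Backtracking: [p] sends the first vertices of [t] to vertices of [s], and
    [m] vertices of [t] remain; the empty list signals failure.  The test
    [relabels] on the result makes it trustworthy. *)
Fixpoint relabelling t s m (p : seq nat) : seq nat :=
  if m is m'.+1 then
    let fix first l :=
      if l is v :: l' then
        if (v \notin p) && all (fun i => (v \in nbs s (nth 0 p i))
                                      == (size p \in nbs t i)) (iota 0 (size p))
        then let q := relabelling t s m' (rcons p v) in
             if q is [::] then first l' else q
        else first l'
      else [::] in
    first (iota 0 (size s))
  else p.

Definition isomorphic_tables t s : bool :=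
  relabels t s (relabelling t s (size t) [::]).

(** * The search *)

(** The case [j = size s] adds a new vertex. *)
Definition link s i j : table :=
  mkseq (fun k => (if k == i then [:: j] else [::])
               ++ (if k == j then [:: i] else [::]) ++ nbs s k)
        (maxn (size s) j.+1).

(** In a symmetric table, walks of length 1 are covered by those of length 3,
    which may turn back. *)
Definition short_walk s i j : bool :=
  [|| i == j, has (fun k => j \in nbs s k) (nbs s i)
    | has (fun k => has (fun l => j \in nbs s l) (nbs s k)) (nbs s i)].

Definition linkable s i j : bool :=
  [&& size (nbs s i) < 3, size (nbs s j) < 3 & ~~ short_walk s i j].

Definition in_pentagon s a b c : bool :=
  has (fun x => (x != b) && has (fun y => (y != b) && (y \in nbs s x)) (nbs s c))
      (nbs s a).

(** The paths on which the next pentagon may be drawn.  Both ends must be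
    saturated, as otherwise the missing edge could leave the drawing; the
    comparison of the ends picks one orientation of each path. *)
Definition pending s : seq (nat * nat * nat) :=
  [seq p <- flatten [seq [seq (a, b, c) | a <- nbs s b, c <- nbs s b]
                        | b <- iota 0 (size s)]
          | [&& p.1.1 < p.2, size (nbs s p.1.1) == 3, size (nbs s p.2) == 3
              & ~~ in_pentagon s p.1.1 p.1.2 p.2]].

Definition unsaturated s : seq nat :=
  [seq i <- iota 0 (size s) | size (nbs s i) < 3].

(** Pentagons are completed before new vertices are drawn: any order would be
    sound, this one keeps the tree small.  Conditionals stand where [==>] would
    be natural, because evaluation by value would explore both arguments. *)
Fixpoint search (targets : seq table) fuel s : bool :=
  if fuel is m.+1 then
    match pending s, unsaturated s with
    | (a, b, c) :: _, _ =>
        all (fun x => all (fun y =>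
          if [&& x != b, y != b & linkable s x y]
          then search targets m (link s x y) else true) (nbs s c)) (nbs s a)
    | [::], i :: _ =>
        search targets m (link s i (size s)) &&
        all (fun j => if linkable s i j
                      then search targets m (link s i j) else true)
            (iota 0 (size s))
    | [::], [::] => has (isomorphic_tables^~ s) targets
    end
  else false.

Definition pentagon_table : table :=
  [:: [:: 1; 4]; [:: 0; 2]; [:: 1; 3]; [:: 2; 4]; [:: 3; 0]].

Lemma nbs_lt s i j : j \in nbs s i -> i < size s.
Proof. by case: (ltnP i (size s)) => // h; rewrite /nbs nth_default. Qed.

Lemma size_link s i j : size (link s i j) = maxn (size s) j.+1.
Proof. exact: size_mkseq. Qed.

Lemma nbs_link s i j k : i < size s ->
  nbs (link s i j) k = (if k == i then [:: j] else [::])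
                    ++ (if k == j then [:: i] else [::]) ++ nbs s k.
Proof.
move=> si; rewrite /nbs /link.
have [h|h] := ltnP k (maxn (size s) j.+1); first by rewrite nth_mkseq.
rewrite nth_default ?size_mkseq //.
move: h; rewrite geq_max => /andP[sk jk].
rewrite [nth _ _ _]nth_default // !gtn_eqF //.
exact: leq_trans sk.
Qed.

Lemma mem_link s i j k l : i < size s ->
  (l \in nbs (link s i j) k) =
  [|| (k == i) && (l == j), (k == j) && (l == i) | l \in nbs s k].
Proof.
move=> si; rewrite nbs_link // !mem_cat.
by case: (k == i); case: (k == j); rewrite /= ?inE.
Qed.

Lemma pending_sound s a b c q : pending s = (a, b, c) :: q ->
  [/\ a != c, a \in nbs s b, c \in nbs s b,
   size (nbs s a) = 3 /\ size (nbs s c) = 3 & ~~ in_pentagon s a b c].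
Proof.
move=> e; have : (a, b, c) \in pending s by rewrite e mem_head.
rewrite mem_filter /= => /andP[/and4P[ac /eqP ? /eqP ? ?]].
move=> /flattenP[_ /mapP[b' _ ->] /allpairsP[[a' c'] /= [ab cb [ea eb ec]]]].
by move: ab cb; rewrite -ea -eb -ec => ab cb; split=> //; rewrite ltn_eqF.
Qed.

End Tables.

(** * Soundness of the search *)

Section Soundness.
Local Open Scope nat_scope.
Variable G : sgraph.
Hypothesis G_locfin : locally_finite G.
Hypothesis G_cubic : regular G 3.
Hypothesis G_connected : connected_graph G.
Hypothesis triangle_free : forall x y z : G,
  adj x y -> adj y z -> adj z x -> False.
Hypothesis square_free : forall x y z w : G,
  adj x y -> adj y z -> adj z w -> adj w x -> x != z -> y != w -> False.
Hypothesis pentagons : forall a b c : G, a != c -> adj b a -> adj b c ->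
  exists x y, [/\ adj a x, adj c y, adj x y, x != b & y != b].

Implicit Types (s t : table) (f : nat -> G) (i j k l : nat).

(** A drawing is a subgraph, not an induced one: two drawn vertices may be
    adjacent in [G] without being so in the table. *)
Definition draws f s : Prop :=
  [/\ {in gtn (size s) &, injective f},
      forall i, uniq (nbs s i),
      forall i j, j \in nbs s i -> i \in nbs s j
    & forall i j, j \in nbs s i -> j < size s /\ adj (f i) (f j)].

Lemma drawn_nb f s i : draws f s ->
  uniq (map f (nbs s i)) /\ {subset map f (nbs s i) <= nb (f i)}.
Proof.
case=> finj us sym sadj; split.
  by rewrite map_inj_in_uniq // => j k /sadj[jl _] /sadj[kl _]; exact: finj.
by move=> _ /mapP[j /sadj[_ h] ->]; rewrite mem_nb.
Qed.

Lemma nbs_le3 f s i : draws f s -> size (nbs s i) <= 3.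
Proof.
move=> /(drawn_nb i)[um sub]; rewrite -(size_nb G_cubic (f i)) -(size_map f).
exact: uniq_leq_size.
Qed.

Lemma saturated f s i y : draws f s -> size (nbs s i) = 3 -> adj (f i) y ->
  exists2 j, j \in nbs s i & f j = y.
Proof.
move=> /(drawn_nb i)[um sub] s3 iy.
have [_ e] := uniq_min_size um sub ltac:(by rewrite size_map s3 size_nb).
have : y \in nb (f i) by rewrite mem_nb.
by rewrite -e => /mapP[j ji ->]; exists j.
Qed.

(** Why discarding the edges that are not linkable loses nothing. *)
Lemma adj_linkable f s i j : draws f s -> i < size s -> j < size s ->
  adj (f i) (f j) -> j \notin nbs s i -> linkable s i j.
Proof.
move=> fs si sj fij nij; have [finj us sym sadj] := fs.
have deg k l : k < size s -> l < size s -> adj (f k) (f l) ->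
    l \notin nbs s k -> size (nbs s k) < 3.
  move=> ks ls kl nkl; rewrite ltn_neqAle (nbs_le3 _ fs) andbT.
  apply/eqP => /(saturated fs) /(_ kl)[m mk /finj ml].
  by move: nkl; rewrite -ml ?mk ?inE //; case: (sadj _ _ mk).
have nji : i \notin nbs s j by apply: contra nij => /sym.
apply/and3P; split; [exact: deg fij nij|by apply: deg nji => //; rewrite adjC|].
apply/negP => /or3P[/eqP eij|/hasP[k ik kj]|/hasP[k ik /hasP[l kl lj]]].
- by move: fij; rewrite eij adj_irr.
- have [_ fik] := sadj _ _ ik; have [_ fkj] := sadj _ _ kj.
  by apply: (triangle_free fik fkj); rewrite adjC.
have [ks fik] := sadj _ _ ik; have [ls fkl] := sadj _ _ kl.
have [_ flj] := sadj _ _ lj.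
(* The walk i k l j cannot turn back, since i and j are not yet linked. *)
apply: (square_free fik fkl flj); first by rewrite adjC.
  by apply: contraNneq nij => /finj ->.
by apply: contraNneq nij => /finj <-.
Qed.

Lemma draws_link_new f s i j : draws f s -> i < size s ->
  {in gtn (size (link s i j)) &, injective f} ->
  i != j -> j \notin nbs s i -> adj (f i) (f j) -> draws f (link s i j).
Proof.
move=> [finj us sym sadj] si finj' ij nij fij; split => //.
- move=> k; rewrite nbs_link //.
  have nji : i \notin nbs s j by apply: contra nij => /sym.
  case: (eqVneq k i) => [->|_]; first by rewrite (negPf ij) /= nij us.
  by case: (eqVneq k j) => [->|_] //=; rewrite ?nji us.
- move=> k l; rewrite !mem_link //.
  by case/or3P => [/andP[-> ->]|/andP[-> ->]|/sym ->]; rewrite ?orbT.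
- have sij : i < size (link s i j) by rewrite size_link leq_max si.
  move=> k l; rewrite mem_link //.
  case/or3P => [/andP[/eqP-> /eqP->]|/andP[/eqP-> /eqP->]|/sadj[sl kl]].
  + by rewrite size_link leq_max ltnSn orbT.
  + by rewrite adjC.
  + by rewrite size_link leq_max sl.
Qed.

Lemma draws_link f s i j : draws f s -> i < size s -> j < size s ->
  linkable s i j -> adj (f i) (f j) -> draws f (link s i j).
Proof.
move=> fs si sj /and3P[_ _ nsw] fij; have [finj us sym sadj] := fs.
apply: draws_link_new => //.
- by rewrite size_link (maxn_idPl sj).
- by apply: contra nsw => /eqP ->; rewrite /short_walk eqxx.
- (* If i and j were linked, i j i j would be a short walk. *)
  apply: contra nsw => h; apply/or3P/Or33/hasP; exists j => //.
  by apply/hasP; exists i => //; apply: sym.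
Qed.

Lemma draws_extend f s i v : draws f s -> i < size s ->
  (forall j, j < size s -> f j <> v) -> adj (f i) v ->
  draws (fun k => if k == size s then v else f k) (link s i (size s)).
Proof.
move=> [finj us sym sadj] si nv iv.
have old k : k < size s -> (k == size s) = false by move=> h; rewrite ltn_eqF.
apply: draws_link_new => //.
- split => // [j k|j k jk].
    by rewrite !inE => sj sk; rewrite !old //; apply: finj.
  by have [sk jk'] := sadj _ _ jk; rewrite !old // (nbs_lt jk).
- have -> : size (link s i (size s)) = (size s).+1.
    by rewrite size_link; apply/maxn_idPr.
  move=> j k; rewrite !inE !(ltnS _ (size s)) (leq_eqVlt j) (leq_eqVlt k).
  case: eqVneq => [->|_] /=; case: eqVneq => [->|_] //= sj sk.
  + by move=> e; case: (nv k sk).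
  + by move=> e; case: (nv j sj).
  + exact: finj.
- by rewrite old.
- by apply/negP => /sadj[]; rewrite ltnn.
- by rewrite eqxx old.
Qed.

Lemma saturated_models f s : 0 < size s -> draws f s ->
  (forall i, i < size s -> size (nbs s i) = 3) -> models G s.
Proof.
move=> s0 fs sat; have [finj us sym sadj] := fs; exists f; split => //.
- apply: connected_ind => //; first by exists (f 0), 0.
  move=> _ y [i si <-] /(saturated fs (sat _ si))[j /sadj[sj _] <-].
  by exists j.
move=> i j; rewrite !inE => si sj.
apply/idP/idP => [/(saturated fs (sat _ si))[k ki]|/sadj[]//].
by move=> /finj <- //; rewrite inE; case: (sadj _ _ ki).
Qed.

Lemma undrawn_nb f s i : draws f s -> size (nbs s i) < 3 ->
  exists2 u, adj (f i) u & u \notin map f (nbs s i).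
Proof.
move=> fs i3; apply: contrapT => h; move: i3; rewrite ltnNge => /negP; apply.
rewrite -(size_nb G_cubic (f i)) -(size_map f).
apply: uniq_leq_size => [|u]; first exact: nb_uniq.
by rewrite mem_nb // => iu; apply/negPn/negP => nu; apply: h; exists u.
Qed.

Lemma search_sound targets fuel f s : 0 < size s ->
  draws f s -> search targets fuel s ->
  exists2 t, t \in targets & models G t.
Proof.
elim: fuel f s => [|m IH] f s s0 fs //=; have [finj us sym sadj] := fs.
have link_gt0 s' i j : 0 < size (link s' i j) by rewrite size_link leq_max orbT.
case ep : (pending s) => [|[[a b] c] l]; last first.
  have [ac ab cb [a3 c3] np] := pending_sound ep => /allP hs.
  have [sa fba] := sadj _ _ ab; have [sc fbc] := sadj _ _ cb.
  have fac : f a != f c by apply: contraNneq ac => /finj ->.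
  have [_ [_ [/(saturated fs a3)[x xa <-] /(saturated fs c3)[y yc <-] xy xb yb]]]
     := pentagons fac fba fbc.
  have {}xb : x != b by apply: contraNneq xb => ->.
  have {}yb : y != b by apply: contraNneq yb => ->.
  have [sx _] := sadj _ _ xa; have [sy _] := sadj _ _ yc.
  have lxy : linkable s x y.
    apply: (adj_linkable fs) => //; apply: contra np => h.
    by apply/hasP; exists x; rewrite // xb; apply/hasP; exists y; rewrite ?yb.
  have /allP/(_ y yc) := hs x xa; rewrite xb yb lxy /= => /IH; apply.
    exact: link_gt0.
  exact: (draws_link fs).
case eu : (unsaturated s) => [|i l].
  case/hasP => t tt st; exists t => //; apply: models_relabels st.
  apply: (saturated_models s0 fs) => i si; apply/eqP.
  rewrite eqn_leq (nbs_le3 _ fs) leqNgt; apply/negP => i3.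
  suff : i \in unsaturated s by rewrite eu.
  by rewrite mem_filter i3 mem_iota.
have : i \in unsaturated s by rewrite eu mem_head.
rewrite mem_filter mem_iota /= add0n => /andP[i3 si].
have [u iu ni] := undrawn_nb fs i3; case/andP => hnew /allP hold.
have [[j sj fj]|nj] := pselect (exists2 j, j < size s & f j = u).
  have lij : linkable s i j.
    apply: (adj_linkable fs) => //; first by rewrite fj.
    by apply: contra ni => h; rewrite -fj map_f.
  have := hold j; rewrite mem_iota add0n /= sj lij => /(_ isT) /IH; apply.
    exact: link_gt0.
  by apply: (draws_link fs) => //; rewrite fj.
apply: (IH _ _ (link_gt0 _ _ _) (draws_extend fs si _ iu) hnew) => j sj fj.
by apply: nj; exists j.
Qed.

Lemma draws_pentagon (b : G) : exists f, draws f pentagon_table.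
Proof.
have [a [c [ac ba bc]]] : exists a c, [/\ a != c, adj b a & adj b c].
  have := nb_uniq b; have := mem_nb G_locfin b; have := size_nb G_cubic b.
  case: (nb b) => [|a [|c l]] //= _ e /andP[]; rewrite inE negb_or => /andP[ac _] _.
  by exists a, c; rewrite -!e !inE !eqxx ?orbT.
have [x [y [ax cy xy xb yb]]] := pentagons ac ba bc.
have xc : x != c.
  apply: contraNneq xb => xc; case: (triangle_free ba (y := a) (z := c)) => //.
    by rewrite -xc.
  by rewrite adjC.
have ya : y != a.
  apply: contraNneq yb => ya; case: (triangle_free bc (y := c) (z := a)) => //.
    by rewrite -ya.
  by rewrite adjC.
exists (nth b [:: b; a; x; y; c]); split.
- move=> i j; rewrite !inE /= => i5 j5 /eqP; rewrite nth_uniq // => [/eqP //|].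
  rewrite /= !inE !negb_or ac xc (adj_neq ba) (adj_neq bc) (adj_neq ax).
  rewrite (adj_neq xy) (eq_sym b x) xb (eq_sym b y) yb (eq_sym a y) ya.
  by rewrite (eq_sym y c) (adj_neq cy).
- by case=> [|[|[|[|[|i]]]]] //; rewrite /nbs /= nth_nil.
- by case=> [|[|[|[|[|i]]]]] j; rewrite /nbs /= ?nth_nil ?inE // => /orP[]/eqP->.
- case=> [|[|[|[|[|i]]]]] j; rewrite /nbs /= ?nth_nil ?inE // => /orP[]/eqP-> /=;
    by split=> //; rewrite // adjC.
Qed.

End Soundness.

(** * The Triplex and the Petersen graph *)

(** Turns a statement about all pairs of labels into a computation. *)
Lemma all_iota2P n (P : rel nat) :
  all (fun i => all (P i) (iota 0 n)) (iota 0 n) ->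
  forall i j, (i < n)%N -> (j < n)%N -> P i j.
Proof.
move=> /allP h i j iN jN; have /allP := h i ltac:(by rewrite mem_iota).
by apply; rewrite mem_iota.
Qed.

Definition triplex_nat_arc (i j : nat) : bool :=
  (j == i.+1 %% 12)%N || ((i.+1, j.+1) \in triplex_chords).

Definition triplex_table : table :=
  adjacency_table 12 (fun i j => triplex_nat_arc i j || triplex_nat_arc j i).

Lemma triplex_models : models triplex triplex_table.
Proof.
apply: (@models_adjacency triplex 12 _ (fun i => inord i : 'I_12)).
- by move=> i j iN jN /(congr1 val) /=; rewrite !inordK.
- by move=> v; exists (val v); rewrite ?ltn_ord //; apply: val_inj; rewrite /= inordK.
- by move=> i j iN jN; rewrite /= /triplex_adj /triplex_arc !inordK.
Qed.

Section Petersen.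
Local Open Scope nat_scope.

Definition pairs5 : seq (nat * nat) :=
  [:: (0, 1); (2, 3); (0, 4); (1, 2); (3, 4);
      (0, 2); (1, 3); (2, 4); (0, 3); (1, 4)].

Definition pair5 (i : nat) : nat * nat := nth (0, 0) pairs5 i.

Definition petersen_rel : rel nat := fun i j =>
  ((pair5 i).1 \notin [:: (pair5 j).1; (pair5 j).2])
  && ((pair5 i).2 \notin [:: (pair5 j).1; (pair5 j).2]).

Definition petersen_table : table := adjacency_table 10 petersen_rel.

Lemma pair5_lt i : i < 10 ->
  [&& (pair5 i).1 < 5, (pair5 i).2 < 5 & (pair5 i).1 != (pair5 i).2].
Proof. by move: i; do 10?[case=> //]. Qed.

Lemma set2_disjoint (T : finType) (a b c d : T) :
  ([set a; b] :&: [set c; d] == finset.set0)%SET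
  = (a \notin [:: c; d]) && (b \notin [:: c; d]).
Proof.
by rewrite finset.setIUl finset.setU_eq0 !finset.setI_eq0 !disjoints1 !inE.
Qed.

Lemma card_default_pair : #|[set (ord0 : 'I_5); ord_max]%SET| == 2.
Proof. by rewrite cards2. Qed.

(** The default value is taken only by pairs that are not vertices. *)
Definition pair_vertex (p : nat * nat) : petersen_vertex :=
  insubd (exist (fun A : {set 'I_5} => #|A| == 2) _ card_default_pair :
            {A : {set 'I_5} | #|A| == 2})
    [set inord p.1; inord p.2]%SET.

Lemma petersen_models : models petersen petersen_table.
Proof.
have inordE (a b : nat) : a < 5 -> b < 5 -> (inord a == inord b :> 'I_5) = (a == b).
  by move=> a5 b5; rewrite -val_eqE /= !inordK.
have val_pair i : i < 10 -> val (pair_vertex (pair5 i)) =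
    [set inord (pair5 i).1; inord (pair5 i).2]%SET.
  by move=> /pair5_lt/and3P[a5 b5 ab]; rewrite val_insubd cards2 inordE // ab.
apply: (@models_adjacency petersen _ _ (fun i => pair_vertex (pair5 i))).
- move=> i j iN jN /(congr1 val); rewrite !val_pair // => /finset.setP e.
  have := e (inord (pair5 i).1); have := e (inord (pair5 i).2).
  have /and3P[a5 b5 ab] := pair5_lt iN; have /and3P[c5 d5 cd] := pair5_lt jN.
  rewrite !inE !eqxx !inordE // ?orbT => h1 h2.
  have : ~~ [&& i != j, (pair5 i).2 \in [:: (pair5 j).1; (pair5 j).2]
              & (pair5 i).1 \in [:: (pair5 j).1; (pair5 j).2]].
    move: i j iN jN {e a5 b5 ab c5 d5 cd h1 h2}; apply: all_iota2P.
    by vm_compute.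
  by rewrite !inE -h1 -h2 !andbT negbK => /eqP.
- move=> v; have /cards2P[a [b [ab vab]]] := valP v.
  have [i iN hi] : exists2 i, i < 10 &
      pair5 i \in [:: (val a, val b); (val b, val a)].
    have : all (fun a => all (fun b => (a != b) ==>
        has (fun p => p \in [:: (a, b); (b, a)]) pairs5) (iota 0 5)) (iota 0 5).
      by vm_compute.
    move/all_iota2P => /(_ (val a) (val b) (ltn_ord a) (ltn_ord b)).
    rewrite val_eqE ab implyTb => /hasP[p pin ?]; exists (index p pairs5).
      by rewrite index_mem.
    by rewrite /pair5 nth_index.
  exists i => //; apply: val_inj; rewrite val_pair // vab.
  by move: hi; rewrite !inE => /orP[]/eqP-> /=; rewrite !inord_val // finset.setUC.
- move=> i j iN jN; rewrite /= /petersen_adj !val_pair // set2_disjoint !inE.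
  have /and3P[a5 b5 _] := pair5_lt iN; have /and3P[c5 d5 _] := pair5_lt jN.
  by rewrite !inordE // /petersen_rel !inE.
Qed.

End Petersen.

(** * The dodecahedron *)

(** All coordinates of its vertices, and all squared distances, lie in the ring
    of integers of Q(sqrt 5): the pair [(a, b)] stands for a + b phi, where phi
    is the golden ratio.  Adjacency thereby becomes decidable by computation
    over every field of real numbers. *)
Definition zphi : Type := (int * int)%type.

Definition zphi_add (z w : zphi) : zphi := (z.1 + w.1, z.2 + w.2).

Definition zphi_sub (z w : zphi) : zphi := (z.1 - w.1, z.2 - w.2).

(** This uses phi^2 = phi + 1. *)
Definition zphi_sqr (z : zphi) : zphi :=
  (z.1 ^+ 2 + z.2 ^+ 2, z.1 * z.2 *+ 2 + z.2 ^+ 2).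

Definition zphi_sqr_dist (u v : seq zphi) : zphi :=
  foldr zphi_add (0, 0) [seq zphi_sqr (zphi_sub w.1 w.2) | w <- zip u v].

(** The inverse of phi is phi - 1, hence the coordinates in [g]. *)
Definition dodecahedron_points : seq (seq zphi) :=
  let o : zphi := (0, 0) in
  let pm (z : zphi) : seq zphi := [:: z; (- z.1, - z.2)] in
  let u := pm (1, 0) in let f := pm (0, 1) in let g := pm (-1, 1) in
  [seq [:: t.1; t.2; z] | t <- [seq (x, y) | x <- u, y <- u], z <- u] ++
  [seq [:: o; x; y] | x <- g, y <- f] ++
  [seq [:: y; o; x] | x <- g, y <- f] ++
  [seq [:: x; y; o] | x <- g, y <- f].

Definition dodecahedron_point (i : nat) : seq zphi :=
  nth [::] dodecahedron_points i.

(** The squared edge length is 4 / phi^2 = 8 - 4 phi. *)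
Definition dodecahedron_table : table :=
  adjacency_table 20 (fun i j =>
    zphi_sqr_dist (dodecahedron_point i) (dodecahedron_point j) == (8, - 4)).

Section Dodecahedron.
Variable R : realType.
Local Notation phi := (golden_ratio R).

Lemma phi_bounds : 8 / 5 < phi < 81 / 50.
Proof.
have h : Num.sqrt 5 ^+ 2 = 5 :> R by rewrite sqr_sqrtr.
have h0 : 0 <= Num.sqrt 5 :> R by exact: sqrtr_ge0.
by rewrite /golden_ratio; apply/andP; split; nra.
Qed.

Lemma phi_sqr : phi ^+ 2 = phi + 1.
Proof.
have h : Num.sqrt 5 ^+ 2 = 5 :> R by rewrite sqr_sqrtr.
rewrite /golden_ratio; lra.
Qed.

Lemma phi_gt0 : 0 < phi.
Proof. have := phi_bounds; lra. Qed.

Lemma phi_inv : phi^-1 = phi - 1.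
Proof.
have p0 : phi != 0 by rewrite gt_eqF ?phi_gt0.
apply: (mulfI p0); rewrite mulfV //; have := phi_sqr; lra.
Qed.

Definition zphi_val (z : zphi) : R := z.1%:~R + z.2%:~R * phi.

Lemma zphi_val0 : zphi_val (0, 0) = 0.
Proof. by rewrite /zphi_val mul0r addr0. Qed.

Lemma zphi_valD z w : zphi_val (zphi_add z w) = zphi_val z + zphi_val w.
Proof. rewrite /zphi_val /= !intrD; ring. Qed.

Lemma zphi_valB z w : zphi_val (zphi_sub z w) = zphi_val z - zphi_val w.
Proof. rewrite /zphi_val /= !intrB; ring. Qed.

Lemma zphi_val_sqr z : zphi_val (zphi_sqr z) = zphi_val z ^+ 2.
Proof.
rewrite /zphi_val /= mulr2n !expr2 !(intrD, intrM).
apply/eqP; rewrite -subr_eq0; apply/eqP.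
transitivity (z.2%:~R ^+ 2 * (phi + 1 - phi * phi)); first by ring.
by rewrite -expr2 phi_sqr subrr mulr0.
Qed.

(** A certificate that z - w has a sign: it has the same strict sign when phi
    is replaced by either of the bounds 8/5 and 81/50.  This avoids the
    irrationality of phi, and is fine enough for the differences that occur. *)
Definition separated (z w : zphi) : bool :=
  let: (a, b) := zphi_sub z w in
  (0 < 5 * a + 8 * b) && (0 < 50 * a + 81 * b)
  || (5 * a + 8 * b < 0) && (50 * a + 81 * b < 0).

Lemma separated_neq z w : separated z w -> zphi_val z != zphi_val w.
Proof.
rewrite -subr_eq0 -zphi_valB /zphi_val /separated.
case: (zphi_sub z w) => a b /=.
rewrite -(ltr_int R) -[X in _ && X || _](ltr_int R).
rewrite -[X in _ || X && _](ltr_int R) -[X in _ || _ && X](ltr_int R).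
rewrite !intrD !intrM; have := phi_bounds => /andP[p1 p2].
move: (a%:~R) (b%:~R) => {}a {}b h.
by apply/eqP => e; case/orP: h => /andP[]; nra.
Qed.

Definition point (u : seq zphi) : 'rV[R]_3 := \row_k zphi_val (nth (0, 0) u k).

Lemma sum_sqr_dist u v : size u = 3 -> size v = 3 ->
  \sum_i (point u 0 i - point v 0 i) ^+ 2 = zphi_val (zphi_sqr_dist u v).
Proof.
case: u => [|u0 [|u1 [|u2 [|]]]] // _; case: v => [|v0 [|v1 [|v2 [|]]]] // _.
rewrite !big_ord_recl big_ord0 !mxE /zphi_sqr_dist.
by rewrite /= !zphi_valD !zphi_val_sqr !zphi_valB zphi_val0.
Qed.

Lemma edge_length u v : size u = 3 -> size v = 3 ->
  (Num.sqrt (\sum_i (point u 0 i - point v 0 i) ^+ 2) == 2 / phi) =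
  (zphi_val (zphi_sqr_dist u v) == zphi_val (8, -4)).
Proof.
move=> su sv; have S0 : 0 <= zphi_val (zphi_sqr_dist u v).
  by rewrite -sum_sqr_dist // sumr_ge0 // => i _; rewrite sqr_ge0.
rewrite sum_sqr_dist //.
have -> : zphi_val (8, -4) = (2 / phi) ^+ 2.
  rewrite phi_inv /zphi_val /=.
  transitivity (8 - 4 * phi : R); first by rewrite intrN mulNr.
  rewrite exprMn sqrrB phi_sqr; ring.
by rewrite -(@eqrXn2 _ 2) ?sqrtr_ge0 ?divr_ge0 ?ltW ?phi_gt0 // sqr_sqrtr.
Qed.

Lemma size_dodecahedron_point i : (i < 20)%N -> size (dodecahedron_point i) = 3.
Proof.
have /allP h : all (fun u => size u == 3)%N dodecahedron_points by vm_compute.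
by move=> iN; apply/eqP/h; rewrite mem_nth.
Qed.

Lemma eqr_norm_zphi (r : R) z : 0 < zphi_val z -> (`|r| == zphi_val z)
  = ((r == zphi_val z) || (r == zphi_val (zphi_sub (0, 0) z))).
Proof.
by move=> z0; rewrite eqr_norml (ltW z0) andbT zphi_valB zphi_val0 sub0r.
Qed.

Let o0 : 'I_3 := @Ordinal 3 0 isT.
Let o1 : 'I_3 := @Ordinal 3 1 isT.
Let o2 : 'I_3 := @Ordinal 3 2 isT.

Lemma ord3P (i : 'I_3) : [\/ i = o0, i = o1 | i = o2].
Proof.
case: i => -[|[|[|//]]] i3; [apply: Or31|apply: Or32|apply: Or33];
  exact: val_inj.
Qed.

Lemma point_eq (v : 'rV[R]_3) z0 z1 z2 : v 0 o0 = zphi_val z0 ->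
  v 0 o1 = zphi_val z1 -> v 0 o2 = zphi_val z2 -> v = point [:: z0; z1; z2].
Proof.
by move=> h0 h1 h2; apply/rowP => i; rewrite mxE; case: (ord3P i) => -> /=.
Qed.

(** Rewriting with [mem_cat] itself would also unfold the explicit lists that
    are concatenated in [dodecahedron_points]. *)
Lemma mem_cat4 (T : eqType) (x : T) (s1 s2 s3 s4 : seq T) :
  (x \in s1 ++ s2 ++ s3 ++ s4)
  = [|| x \in s1, x \in s2, x \in s3 | x \in s4].
Proof. by rewrite !mem_cat. Qed.

Lemma dodecahedron_vertexP (v : 'rV[R]_3) :
  reflect (exists2 u, u \in dodecahedron_points & v = point u)
          (is_dodecahedron_vertex v).
Proof.
have one_val : 1 = zphi_val (1, 0) by rewrite /zphi_val mul0r addr0.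
have phi_val : phi = zphi_val (0, 1) by rewrite /zphi_val mul1r add0r.
have inv_val : phi^-1 = zphi_val (-1, 1).
  by rewrite phi_inv /zphi_val mul1r addrC.
have abs1 (r : R) :
    (`|r| == 1) = (r \in map zphi_val [:: (1, 0); (- 1, 0)]).
  by rewrite !inE one_val eqr_norm_zphi -?one_val // one_val.
have absphi (r : R) :
    (`|r| == phi) = (r \in map zphi_val [:: (0, 1); (0, -1)]).
  by rewrite !inE {1}phi_val eqr_norm_zphi -?phi_val ?phi_gt0 // phi_val.
have absinv (r : R) :
    (`|r| == phi^-1) = (r \in map zphi_val [:: (- 1, 1); (1, -1)]).
  by rewrite !inE inv_val eqr_norm_zphi -?inv_val ?invr_gt0 ?phi_gt0 // inv_val.
have ord_add : (o0 + 1 = o1) * (o0 + 2 = o2) * (o1 + 1 = o2) * (o1 + 2 = o0)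
     * (o2 + 1 = o0) * (o2 + 2 = o1) by do !split; apply: val_inj.
apply: (iffP orP) => [[/forallP h|/existsP[i /and3P[/eqP h0]]]|[u]].
- have := h o0; have := h o1; have := h o2; rewrite !abs1.
  move=> /mapP[z2 m2 e2] /mapP[z1 m1 e1] /mapP[z0 m0 e0].
  exists [:: z0; z1; z2]; last exact: point_eq.
  rewrite mem_cat4; apply/or4P/Or41.
  exact: (allpairs_f (fun t z => [:: t.1; t.2; z]) (allpairs_f pair m0 m1) m2).
- rewrite absinv absphi => /mapP[x mx ex] /mapP[y my ey].
  rewrite -zphi_val0 in h0.
  case: (ord3P i) h0 ex ey => -> ; rewrite !ord_add => h0 ex ey.
  + exists [:: (0, 0); x; y]; last exact: point_eq.
    rewrite mem_cat4; apply/or4P/Or42.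
    exact: (allpairs_f (fun x y => [:: (0, 0); x; y]) mx my).
  + exists [:: y; (0, 0); x]; last exact: point_eq.
    rewrite mem_cat4; apply/or4P/Or43.
    exact: (allpairs_f (fun x y => [:: y; (0, 0); x]) mx my).
  + exists [:: x; y; (0, 0)]; last exact: point_eq.
    rewrite mem_cat4; apply/or4P/Or44.
    exact: (allpairs_f (fun x y => [:: x; y; (0, 0)]) mx my).
rewrite mem_cat4 => /or4P[]/allpairsP[[x y] [mx my ->]] ->.
- case/allpairsP: mx => -[a b] [ma mb /= ->]; left; apply/forallP => i.
  by case: (ord3P i) => ->; rewrite mxE /= abs1 map_f.
- right; apply/existsP; exists o0; rewrite !ord_add !mxE /= zphi_val0 eqxx.
  by rewrite absinv absphi !map_f.
- right; apply/existsP; exists o1; rewrite !ord_add !mxE /= zphi_val0 eqxx.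
  by rewrite absinv absphi !map_f.
- right; apply/existsP; exists o2; rewrite !ord_add !mxE /= zphi_val0 eqxx.
  by rewrite absinv absphi !map_f.
Qed.

Lemma dodecahedron_models : models (dodecahedral_graph R) dodecahedron_table.
Proof.
pose f i := point (dodecahedron_point i).
have fP i : (i < 20)%N -> is_dodecahedron_vertex (f i).
  move=> iN; apply/dodecahedron_vertexP; exists (dodecahedron_point i) => //.
  by rewrite mem_nth.
pose v0 : {v : 'rV[R]_3 | is_dodecahedron_vertex v} :=
  exist (fun v => is_dodecahedron_vertex v) _ (fP 0%N isT).
pose g i : dodecahedral_graph R := insubd v0 (f i).
have gE i : (i < 20)%N -> val (g i) = f i.
  by move=> iN; rewrite val_insubd fP.
apply: (@models_adjacency (dodecahedral_graph R) 20 _ g).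
- move=> i j iN jN /(congr1 val); rewrite !gE // => /rowP e.
  pose z k i := nth (0, 0) (dodecahedron_point i) k.
  have : (i == j) || [|| separated (z 0 i) (z 0 j), separated (z 1 i) (z 1 j)
                       | separated (z 2 i) (z 2 j)].
    by move: i j iN jN {e}; apply: all_iota2P; vm_compute.
  case/orP => [/eqP //|/or3P[]] /separated_neq/eqP[].
  + by have := e o0; rewrite !mxE.
  + by have := e o1; rewrite !mxE.
  + by have := e o2; rewrite !mxE.
- move=> v; have /dodecahedron_vertexP[u up vu] := valP v.
  have iN : (index u dodecahedron_points < 20)%N by rewrite index_mem.
  exists (index u dodecahedron_points) => //; apply: val_inj.
  by rewrite gE // vu /f /dodecahedron_point nth_index.
- move=> i j iN jN; rewrite /= /dodecahedron_adj !gE //.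
  rewrite edge_length ?size_dodecahedron_point //.
  set d := zphi_sqr_dist _ _.
  have : (d == (8, -4)) || separated d (8, -4).
    by rewrite /d; move: i j iN jN {d}; apply: all_iota2P; vm_compute.
  by case: eqVneq => [->|_ /separated_neq/negPf]; rewrite ?eqxx.
Qed.

End Dodecahedron.

(** * The classification *)

(** Every step adds an edge to the five of the pentagon, and a cubic graph with
    20 vertices has 30 edges: 26 levels suffice. *)
Lemma search_succeeds :
  search [:: petersen_table; triplex_table; dodecahedron_table] 26
    pentagon_table.
Proof. by vm_compute. Qed.

Theorem theorem1 (R : realType) (G : sgraph)
    (G_locfin : locally_finite G)
    (G_connected : connected_graph G)
    (G_cubic : regular G 3)
    (G_girth : (5%:R%:E <= girth R G)%E)
    (G_flat : forall x y : G, adj x y -> has_curvature x y (0 : \bar R)%E) :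
  sg_iso G petersen \/ sg_iso G triplex \/ sg_iso G (dodecahedral_graph R).
Proof.
have pent := flat_pentagons G_locfin G_cubic G_girth G_flat.
have tri := @no_triangle G R G_girth.
have [[b _] _] := G_connected.
have [f fp] := draws_pentagon G_locfin G_cubic tri pent b.
have s0 : (0 < size pentagon_table)%N by [].
have [t] := search_sound G_locfin G_cubic G_connected tri
  (@no_square G R G_girth) pent s0 fp search_succeeds.
rewrite !inE => /or3P[]/eqP-> Gt; [left|right; left|right; right].
- exact: models_iso Gt petersen_models.
- exact: models_iso Gt triplex_models.
- exact: models_iso Gt (dodecahedron_models R).
Qed.
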